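(* Let $P=\{p_1,p_2,\dots,p_k\}$ be a nonempty set of permutations of $\{1,\dots,n\}$ that is a groupe de permutations. Then the groupe de substitutions associated with $P$ is a group (under composition).
   Context: Permutations are composed from right to left. For permutations $p,q\in S_n$, the substitution $\begin{pmatrix}p\\ q\end{pmatrix}$ is the map sending $p(s)$ to $q(s)$ for each $s$, i.e. the permutation $qp^{-1}$. A nonempty set $P=\{p_1,\dots,p_k\}$ of permutations is a groupe de permutations if for every $1\le i\le k$ the set of substitutions $\left\{\begin{pmatrix}p_1\\ p_j\end{pmatrix}:1\le j\le k\right\}$ equals the set of substitutions $\left\{\begin{pmatrix}p_i\\ p_j\end{pmatrix}:1\le j\le k\right\}$. When this holds, this common set of substitutions is called the groupe de substitutions associated with $P$. *)

(* Defs.v *)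
From mathcomp Require Import all_boot all_fingroup.

Set Implicit Arguments.
Unset Strict Implicit.
Unset Printing Implicit Defensive.

Local Open Scope group_scope.

(* The product of MathComp permutations reads from left to right,             *)
(* (s * t) x = t (s x), so q p^-1 composed from right to left is p^-1 * q.    *)
Definition substitution (n : nat) (p q : 'S_n) : 'S_n := p^-1 * q.

Lemma substitutionE (n : nat) (p q : 'S_n) (s : 'I_n) :
  substitution p q (p s) = q s.
Proof. by rewrite /substitution permM permK. Qed.

Definition substitutions_from (n : nat) (P : {set 'S_n}) (p : 'S_n) :
  {set 'S_n} := [set substitution p q | q in P].

(* Any element of P may be listed first, whence the quantification over p1.   *)
Definition groupe_de_permutations (n : nat) (P : {set 'S_n}) : Prop :=
  P != set0 /\
  forall p1 p : 'S_n, p1 \in P -> p \in P ->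
    substitutions_from P p1 = substitutions_from P p.

(* repr P is some element of P when P is nonempty; by the next lemma its      *)
(* choice is irrelevant when P is a groupe de permutations.                   *)
Definition groupe_de_substitutions (n : nat) (P : {set 'S_n}) : {set 'S_n} :=
  substitutions_from P (repr P).

Lemma groupe_de_substitutionsE (n : nat) (P : {set 'S_n}) (p : 'S_n) :
  groupe_de_permutations P -> p \in P ->
  groupe_de_substitutions P = substitutions_from P p.
Proof. by case=> _ eqP Pp; apply: eqP => //; apply: mem_repr Pp. Qed.

(* Main.v *)
Require Import Defs.
From mathcomp Require Import all_boot all_fingroup.

(** The set of substitutions is the translate [p^-1 * P], and the hypothesis says that it is the
    same for every base [p] in [P]. Closure under product follows by basing the second factor at the
    endpoint of the first. *)

Theorem lemma3 (n : nat) (P : {set 'S_n}) :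
  groupe_de_permutations P ->
  exists G : {group 'S_n}, groupe_de_substitutions P = G :> {set 'S_n}.
Proof.
move=> gP; have [/set0Pn[p Pp] eqP] := gP.
rewrite (groupe_de_substitutionsE gP Pp).
suff gS : group_set (substitutions_from P p) by exists (Group gS).
(* As ['S_n] is finite, the identity and closure under product suffice; inverses come for free. *)
apply/group_setP; split=> [|x y /imsetP[q Pq ->]].
  by apply/imsetP; exists p => //; rewrite /substitution mulVg.
(* Rebasing the second factor at q makes the product telescope:               *)
(* (p^-1 * q) * (q^-1 * r) = p^-1 * r.                                        *)
rewrite {1}(eqP p q Pp Pq) => /imsetP[r Pr ->].
by apply/imsetP; exists r => //; rewrite /substitution mulgA mulgK.
Qed.
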